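(* Let $(\bar A,\bar B)$ be a structurally controllable structured system with $n$ states and $m$ inputs, let $p_u(j)\ge 0$, $j=1,\dots,m$, be input costs, and let $q$ be the number of non-top linked SCC's of $D(\bar A)$. Let $\Delta$ be the maximum in-degree of the nodes $u'_1,\dots,u'_m$ in the flow network $F(\bar A,\bar B,c)$. Let $f^\star_{LP}$ be an integer-valued optimal solution of the linear program (LP). Then $f^\star_{LP}$ is a $\Delta$-approximate solution of MCFF$(q+n)$ on $F(\bar A,\bar B,c)$, i.e. $c_{f^\star_{LP}}\le\Delta\,c^\star$.
   Context: Structured systems. A structured system is a pair $(\bar A,\bar B)$ with $\bar A\in\{0,\star\}^{n\times n}$, $\bar B\in\{0,\star\}^{n\times m}$. A numerical realization is a pair of real matrices $(A,B)$ of the same sizes with $A_{ij}=0$ whenever $\bar A_{ij}=0$ and $B_{ij}=0$ whenever $\bar B_{ij}=0$. $(\bar A,\bar B)$ is structurally controllable if some numerical realization $(A,B)$ is controllable, i.e. $\mathrm{rank}[B\ AB\ \cdots\ A^{n-1}B]=n$. State digraph and SCC's. $D(\bar A)$ has vertices $x_1,\dots,x_n$ and a directed edge $(x_j,x_i)$ iff $\bar A_{ij}\ne 0$. SCC means strongly connected component; an SCC is non-top linked if it has no incoming edges to its vertices from vertices of another SCC. Let $\mathcal N_1,\dots,\mathcal N_q$ be the non-top linked SCC's of $D(\bar A)$. Flow network $F(\bar A,\bar B,c)$. Vertex set $V_F=\{s,t\}\cup\{\mathcal N_i\}_{i=1}^q\cup\{x'_k\}_{k=1}^n\cup\{x_r\}_{r=1}^n\cup\{u_j\}_{j=1}^m\cup\{u'_j\}_{j=1}^m$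 with source $s$ and sink $t$. Directed edge set $E_F$: $(s,\mathcal N_i)$ for all $i$; $(s,x'_k)$ for all $k$; $(\mathcal N_i,u'_j)$ whenever $\bar B_{rj}=\star$ for some $x_r\in\mathcal N_i$; $(x'_k,x_r)$ whenever $\bar A_{kr}\neq0$; $(x'_k,u_j)$ whenever $\bar B_{kj}\ne0$; $(u_j,u'_j)$ for all $j$; $(u'_j,t)$ for all $j$; $(x_r,t)$ for all $r$. Capacities: $b((u'_j,t))=n+1$ for all $j$, and $b(e)=1$ for every other edge. Costs: $c((u'_j,t))=p_u(j)$ for all $j$, and $c(e)=0$ for every other edge. Flows, MCFF and LP. A flow vector is a function $f:E_F\to\mathbb R_{\ge0}$. It is feasible if $f(e)\le b(e)$ for all $e$ and, at every vertex other than $s,t$, total outgoing flow equals total incoming flow. Put $\varphi_f=\sum_{e=(s,v)\in E_F}f(e)$ and $c_f=\sum_{e:f(e)>0}c(e)$. The minimum cost fixed flow problem MCFF$(q+n)$ is: minimize $c_f$ over feasible flow vectors $f$ with $\varphi_f\ge q+n$. Its optimal value is $c^\star$. The linear program (LP) is: minimize $C_f=\sum_{e\in E_F}c(e)f(e)$ over feasible flow vectors $f$ with $\varphi_f\ge q+n$. *)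

(* Defs.v *)
From HB Require Import structures.
From mathcomp Require Import all_boot all_order all_algebra.
From mathcomp Require Import classical_sets reals.
Set Implicit Arguments.
Unset Strict Implicit.
Unset Printing Implicit Defensive.
Import Order.TTheory GRing.Theory Num.Theory.
Local Open Scope ring_scope.

(* A pattern in {0,*}^(n x m) is a boolean matrix, with true standing for *.  *)

Definition realizes (R : realType) (n m : nat) (Mbar : 'M[bool]_(n, m))
    (M : 'M[R]_(n, m)) : Prop :=
  forall i j, Mbar i j = false -> M i j = 0.

Definition controllable (R : realType) (n m : nat)
    (A : 'M[R]_n) (B : 'M[R]_(n, m)) : Prop :=
  \rank (\mxrow_(i < n) (A ^+ i *m B)) = n.

Definition structurally_controllable (R : realType) (n m : nat)
    (Abar : 'M[bool]_n) (Bbar : 'M[bool]_(n, m)) : Prop :=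
  exists (A : 'M[R]_n) (B : 'M[R]_(n, m)),
    [/\ realizes Abar A, realizes Bbar B & controllable A B].

(* Column index to row index: x_j -> x_i iff Abar i j is nonzero. *)
Definition state_digraph (n : nat) (Abar : 'M[bool]_n) : rel 'I_n :=
  fun j i => Abar i j.

Definition scc (T : finType) (D : rel T) (x : T) : {set T} :=
  [set y | connect D x y && connect D y x].

Definition sccs (T : finType) (D : rel T) : {set {set T}} :=
  [set scc D x | x : T].

Definition non_top_linked (T : finType) (D : rel T) (N : {set T}) : bool :=
  [forall (M | (M \in sccs D) && (M != N)),
    [forall y in M, [forall x in N, ~~ D y x]]].

Definition ntl_sccs (T : finType) (D : rel T) : {set {set T}} :=
  [set N in sccs D | non_top_linked D N].

Definition edge (V : finType) (E : rel V) : Type := {e : V * V | E e.1 e.2}.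

Section Flow.
Variables (R : realType) (V : finType) (E : rel V) (s t : V).
Variables (b c : edge E -> R).

Definition edge_tail (e : edge E) : V := (val e).1.
Definition edge_head (e : edge E) : V := (val e).2.

Definition indegree (v : V) : nat := #|[set e : edge E | edge_head e == v]|.

Definition outflow (f : edge E -> R) (v : V) : R :=
  \sum_(e : edge E | edge_tail e == v) f e.

Definition inflow (f : edge E -> R) (v : V) : R :=
  \sum_(e : edge E | edge_head e == v) f e.

Definition feasible_flow (f : edge E -> R) : Prop :=
  [/\ forall e, 0 <= f e,
      forall e, f e <= b e
    & forall v, v != s -> v != t -> outflow f v = inflow f v].

Definition flow_value (f : edge E -> R) : R := outflow f s.

Definition fixed_cost (f : edge E -> R) : R :=
  \sum_(e : edge E | 0 < f e) c e.

Definition linear_cost (f : edge E -> R) : R :=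
  \sum_(e : edge E) c e * f e.

(* The common feasible set of MCFF(k) and of its linear program. *)
Definition fixed_flow (k : nat) (f : edge E -> R) : Prop :=
  feasible_flow f /\ k%:R <= flow_value f.

(* fixed_cost takes finitely many values, so this infimum is a minimum as
   soon as some flow is admissible. *)
Definition mcff_opt (k : nat) : R :=
  inf [set fixed_cost f | f in fixed_flow k]%classic.

Definition mcff_approx (k : nat) (alpha : R) (f : edge E -> R) : Prop :=
  fixed_flow k f /\ fixed_cost f <= alpha * mcff_opt k.

Definition lp_optimal (k : nat) (f : edge E -> R) : Prop :=
  fixed_flow k f /\ forall g, fixed_flow k g -> linear_cost f <= linear_cost g.

End Flow.

Section Network.
Variables (n m : nat) (Abar : 'M[bool]_n) (Bbar : 'M[bool]_(n, m)).

Definition ntl_index : Type := {N | N \in ntl_sccs (state_digraph Abar)}.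

Inductive vertex : Type :=
  | Source | Sink
  | Ntl of ntl_index
  | Vx' of 'I_n | Vx of 'I_n
  | Vu of 'I_m | Vu' of 'I_m.

Definition vertex_code (v : vertex) :
    bool + ntl_index + ('I_n + 'I_n) + ('I_m + 'I_m) :=
  match v with
  | Source => inl (inl (inl true))
  | Sink => inl (inl (inl false))
  | Ntl N => inl (inl (inr N))
  | Vx' k => inl (inr (inl k))
  | Vx r => inl (inr (inr r))
  | Vu j => inr (inl j)
  | Vu' j => inr (inr j)
  end.

Definition vertex_decode
    (c : bool + ntl_index + ('I_n + 'I_n) + ('I_m + 'I_m)) : vertex :=
  match c with
  | inl (inl (inl true)) => Source
  | inl (inl (inl false)) => Sink
  | inl (inl (inr N)) => Ntl N
  | inl (inr (inl k)) => Vx' k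
  | inl (inr (inr r)) => Vx r
  | inr (inl j) => Vu j
  | inr (inr j) => Vu' j
  end.

Lemma vertex_codeK : cancel vertex_code vertex_decode.
Proof. by case. Qed.

HB.instance Definition _ := Finite.copy vertex (can_type vertex_codeK).

Definition network_edge : rel vertex := fun v w =>
  match v, w with
  | Source, Ntl _ => true
  | Source, Vx' _ => true
  | Ntl N, Vu' j => [exists r in val N, Bbar r j]
  | Vx' k, Vx r => Abar k r
  | Vx' k, Vu j => Bbar k j
  | Vu i, Vu' j => i == j
  | Vu' _, Sink => true
  | Vx _, Sink => true
  | _, _ => false
  end.

Definition network_capacity (R : realType) (e : edge network_edge) : R :=
  match edge_tail e, edge_head e with
  | Vu' _, Sink => n.+1%:R
  | _, _ => 1
  end.

Definition network_cost (R : realType) (p : 'I_m -> R)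
    (e : edge network_edge) : R :=
  match edge_tail e, edge_head e with
  | Vu' j, Sink => p j
  | _, _ => 0
  end.

Definition max_indegree_up : nat := \max_(j < m) indegree network_edge (Vu' j).

End Network.

Arguments Source {n m Abar}.
Arguments Sink {n m Abar}.
Arguments network_edge {n m} Abar Bbar.
Arguments network_capacity {n m Abar Bbar} R e.
Arguments max_indegree_up {n m} Abar Bbar.

(* Main.v *)
Require Import Defs.
From mathcomp Require Import all_boot all_order all_algebra.
From mathcomp Require Import classical_sets reals.
Set Implicit Arguments.
Unset Strict Implicit.
Unset Printing Implicit Defensive.
Import Order.TTheory GRing.Theory Num.Theory.
Local Open Scope ring_scope.

(** The fixed cost of an integral flow is at most its linear cost, and the
    linear cost of any feasible flow is at most [Delta] times its fixed cost;
    the optimality of [f] for the linear cost links the two bounds.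

    On an edge that an integral flow uses, the flow is at least one, whence
    the first bound ([fixed_cost_le_linear_cost]).  For the second, the only
    edges with a price are the [(u'_j, t)].  The flow on such an edge is at
    most the outflow of [u'_j], which by conservation is the inflow of [u'_j],
    and this is at most the in-degree of [u'_j] because all edges entering
    [u'_j] have capacity one ([priced_flow_le_max_indegree]); summing over the
    edges gives [linear_cost_le_fixed_cost].  Thus
    [fixed_cost f <= linear_cost f <= linear_cost g <= Delta * fixed_cost g]
    for every admissible [g], and it remains to take the infimum over [g]
    ([integral_lp_optimal_approx]). *)

Section Costs.
Variables (R : realType) (V : finType) (E : rel V).
Implicit Types (b c f g : edge E -> R) (D : R).

(** A positive integer is at least one, so each edge in use already pays its
    full price in the linear cost. *)
Lemma fixed_cost_le_linear_cost c f :
  (forall e, 0 <= c e) -> (forall e, 0 <= f e) ->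
  (forall e, f e \is a Num.int) ->
  fixed_cost c f <= linear_cost c f.
Proof.
move=> c_ge0 f_ge0 f_int; rewrite /fixed_cost /linear_cost big_mkcond /=.
apply: ler_sum => e _; case: ifP => [fe_gt0|_]; last exact: mulr_ge0.
apply: ler_peMr => //; rewrite -(gtr0_norm fe_gt0).
by apply: norm_intr_ge1; rewrite ?gt_eqF.
Qed.

Lemma linear_cost_le_fixed_cost c g D :
  (forall e, 0 <= c e) -> (forall e, 0 <= g e) ->
  (forall e, c e != 0 -> g e <= D) ->
  linear_cost c g <= D * fixed_cost c g.
Proof.
move=> c_ge0 g_ge0 gD; rewrite /fixed_cost /linear_cost mulr_sumr.
rewrite [leRHS]big_mkcond /=; apply: ler_sum => e _.
case: ltP => [_|ge_le0].
  have [->|ce_neq0] := eqVneq (c e) 0; first by rewrite mul0r mulr0.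
  by rewrite [leRHS]mulrC ler_wpM2l // gD.
by have /eqP-> : g e == 0; [rewrite eq_le ge_le0 g_ge0|rewrite mulr0].
Qed.

Lemma inflow_le_indegree g (v : V) :
  (forall e, edge_head e = v -> g e <= 1) -> inflow g v <= (indegree E v)%:R.
Proof.
move=> g_le1; rewrite /indegree -sum1_card natr_sum /inflow.
rewrite [leRHS](eq_bigl (fun e : edge E => edge_head e == v)) => [|e].
  by apply: ler_sum => e /eqP; exact: g_le1.
by rewrite inE.
Qed.

Lemma edge_flow_le_outflow g (e : edge E) :
  (forall e', 0 <= g e') -> g e <= outflow g (edge_tail e).
Proof.
by move=> g_ge0; rewrite /outflow (bigD1 e) //= lerDl sumr_ge0.
Qed.

Lemma integral_lp_optimal_approx (s t : V) b c k D f :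
  0 <= D -> (forall e, 0 <= c e) ->
  (forall g, fixed_flow s t b k g -> forall e, c e != 0 -> g e <= D) ->
  lp_optimal s t b c k f -> (forall e, f e \is a Num.int) ->
  mcff_approx s t b c k D f.
Proof.
move=> D_ge0 c_ge0 priced_le [f_adm f_opt] f_int; split=> //.
have f_le g : fixed_flow s t b k g -> fixed_cost c f <= D * fixed_cost c g.
  move=> g_adm.
  have [[f_ge0 _ _] _] := f_adm; have [[g_ge0 _ _] _] := g_adm.
  apply: le_trans (fixed_cost_le_linear_cost c_ge0 f_ge0 f_int) _.
  apply: le_trans (f_opt g g_adm) _.
  by apply: linear_cost_le_fixed_cost => //; exact: priced_le.
(* Dividing by [D] turns the bounds [f_le] into a lower bound of the fixed
   costs; for [D = 0] the bound [f_le] at [f] itself suffices. *)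
have [D0|D_neq0] := eqVneq D 0.
  by have := f_le f f_adm; rewrite D0 !mul0r.
have D_gt0 : 0 < D by rewrite lt_def D_neq0.
rewrite -ler_pdivrMl //; apply: lb_le_inf.
  by exists (fixed_cost c f), f.
by move=> _ [g g_adm <-]; rewrite ler_pdivrMl // f_le.
Qed.

End Costs.

Section PricedEdges.
Variables (R : realType) (n m : nat).
Variables (Abar : 'M[bool]_n) (Bbar : 'M[bool]_(n, m)) (p : 'I_m -> R).

Lemma network_cost_ge0 (e : edge (network_edge Abar Bbar)) :
  (forall j, 0 <= p j) -> 0 <= network_cost p e.
Proof.
by rewrite /network_cost => p_ge0; case: (edge_tail e) => *; case: (edge_head e).
Qed.

Lemma network_cost_neq0 (e : edge (network_edge Abar Bbar)) :
  network_cost p e != 0 -> exists j, edge_tail e = Vu' Abar j.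
Proof.
rewrite /network_cost; case: (edge_tail e) => [||N|k|r|j|j]; rewrite ?eqxx //.
by exists j.
Qed.

Lemma network_capacity_into_u' (e : edge (network_edge Abar Bbar)) (j : 'I_m) :
  edge_head e = Vu' Abar j -> network_capacity R e = 1.
Proof. by rewrite /network_capacity => ->; case: (edge_tail e). Qed.

(** A priced edge leaves some [u'_j], which is neither source nor sink, so its
    flow is at most the inflow of [u'_j] through edges of capacity one. *)
Lemma priced_flow_le_max_indegree (g : edge (network_edge Abar Bbar) -> R) e :
  feasible_flow Source Sink (network_capacity R) g ->
  network_cost p e != 0 -> g e <= (max_indegree_up Abar Bbar)%:R.
Proof.
move=> [g_ge0 g_cap g_cons] /network_cost_neq0[j tail_e].
apply: le_trans (edge_flow_le_outflow e g_ge0) _.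
rewrite tail_e g_cons //.
apply: (@le_trans _ _ (indegree (network_edge Abar Bbar) (Vu' Abar j))%:R).
  by apply: inflow_le_indegree => e' /network_capacity_into_u' <-.
by rewrite ler_nat /max_indegree_up; exact: leq_bigmax.
Qed.

End PricedEdges.

Theorem mainTheorem4 (R : realType) (n m : nat)
    (Abar : 'M[bool]_n) (Bbar : 'M[bool]_(n, m)) (p : 'I_m -> R)
    (q : nat) (f : edge (network_edge Abar Bbar) -> R) :
  structurally_controllable R Abar Bbar ->
  (forall j, 0 <= p j) ->
  q = #|ntl_sccs (state_digraph Abar)| ->
  lp_optimal Source Sink (network_capacity R)
    (network_cost p) (q + n) f ->
  (forall e, f e \is a Num.int) ->
  mcff_approx Source Sink (network_capacity R)
    (network_cost p) (q + n) (max_indegree_up Abar Bbar)%:R f.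
Proof.
move=> _ p_ge0 _; apply: integral_lp_optimal_approx => //.
  by move=> e; exact: network_cost_ge0.
by move=> g [g_feas _] e; exact: priced_flow_le_max_indegree.
Qed.
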